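(* Let $N\ge0$ be an integer and $\alpha,\beta,\mu$ real parameters, and let $|e_n\rangle,|e_n^*\rangle,|f_n\rangle,|f_n^*\rangle$ ($n=0,\dots,N$) be the eigenvectors defined in the context. Put $$\hat\alpha=-1-\beta-\mu,\qquad \hat\beta=\mu-\beta-1,$$ and assume the parameters are generic, i.e. $\mu_0,\dots,\mu_N$ are pairwise distinct and no denominator below vanishes. Then for all $m,n=0,\dots,N$ the functions $S_m(n)=\langle e_m|f_n^*\rangle$ and $\tilde S_m(n)=\langle e_m^*|f_n\rangle$ are expressed in terms of Hahn polynomials by $$S_m(n)=\frac{a_0a_1\cdots a_{n-1}}{a_0a_1\cdots a_{m-1}}\,\frac{N!\,(-1)^n}{n!\,(N-m)!}\,\frac{(\hat\alpha+1)_n}{(m+\hat\alpha+\hat\beta+1)_m}\,Q_m(n;\hat\alpha,\hat\beta,N),$$ $$\tilde S_m(n)=\frac{a_na_{n+1}\cdots a_{N-1}}{a_ma_{m+1}\cdots a_{N-1}}\,\frac{N!\,(-1)^n(\hat\alpha+1)_m}{m!\,(N-n)!\,(\hat\beta+1)_m}\,\frac{(\hat\beta+1)_{N-n}}{(2m+\hat\alpha+\hat\beta+2)_{N-m}}\,Q_m(n;\hat\alpha,\hat\beta,N).$$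
   Context: $\mathcal M$ is the real vector space with orthonormal basis $\{|n\rangle:n=0,\dots,N\}$ ($\langle\ell|k\rangle=\delta_{\ell,k}$); ${}^\top$ denotes transpose in this basis. $a_0,\dots,a_{N-1}$ are nonzero real constants and $a_N=0$. The operators $Z,X,V$ (a representation of the meta Hahn algebra) are $$Z|n\rangle=-|n\rangle+a_n|n+1\rangle,\qquad X|n\rangle=(n-\alpha)|n\rangle-a_n(n-\beta)|n+1\rangle,$$ $$V|n\rangle=(\beta-n)(n-\beta-1)|n\rangle-\frac{n(N+1-n)}{a_{n-1}}|n-1\rangle$$ (terms $|N+1\rangle$ for $n=N$ and $|-1\rangle$ for $n=0$ are absent), and $W=X+\mu Z$. With $\mu_n=(\beta-n)(n-\beta-1)$ and $\rho_n=n-\alpha-\mu$, the vectors are the solutions of $$V|e_n\rangle=\mu_n|e_n\rangle,\quad V^\top|e_n^*\rangle=\mu_n|e_n^*\rangle,\quad W|f_n\rangle=\rho_n|f_n\rangle,\quad W^\top|f_n^*\rangle=\rho_n|f_n^*\rangle,$$ normalized so that the coefficient of $|n\rangle$ in each of $|e_n\rangle,|e_n^*\rangle,|f_n\rangle,|f_n^*\rangle$ is $1$. Hahn polynomials: for $m=0,\dots,N$, $$Q_m(x;\hat\alpha,\hat\beta,N)={}_3F_2\!\left(\begin{matrix}-m,\ m+\hat\alpha+\hat\beta+1,\ -x\\ -N,\ \hat\alpha+1\end{matrix};1\right)=\sum_{\ell=0}^{m}\frac{(-m)_\ell(m+\hat\alpha+\hat\beta+1)_\ell(-x)_\ell}{\ell!\,(-N)_\ell(\hat\alpha+1)_\ell}.$$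 Here $(x)_0=1$, $(x)_k=x(x+1)\cdots(x+k-1)$; empty products of the $a_j$ equal $1$. *)

(* Defs.v *)
From HB Require Import structures.
From mathcomp Require Import all_boot all_order all_algebra.
From mathcomp Require Import reals.

Set Implicit Arguments.
Unset Strict Implicit.
Unset Printing Implicit Defensive.

Import Order.TTheory GRing.Theory Num.Theory.
Local Open Scope ring_scope.

(* The space spanned by the orthonormal basis |0>, ..., |N> is 'cV[R]_N.+1, so
   that the transpose in this basis is the matrix transpose. *)

Section MetaHahn.

Variables (R : realType) (N : nat).

(* The basis vector |k>. For k > N this is the zero vector, which accounts for
   the absence of the terms |N+1> below. *)
Definition ket (k : nat) : 'cV[R]_N.+1 := \col_(i < N.+1) (i == k :> nat)%:R.

Definition braket (u v : 'cV[R]_N.+1) : R := (u^T *m v) 0 0.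

(* The operator mapping |n> to F n for n = 0, ..., N. *)
Definition op_of (F : nat -> 'cV[R]_N.+1) : 'M[R]_N.+1 :=
  \matrix_(i < N.+1, n < N.+1) F n i 0.

Definition opZ (a : nat -> R) : 'M[R]_N.+1 :=
  op_of (fun n => - ket n + a n *: ket n.+1).

Definition opX (a : nat -> R) (alpha beta : R) : 'M[R]_N.+1 :=
  op_of (fun n =>
    (n%:R - alpha) *: ket n - (a n * (n%:R - beta)) *: ket n.+1).

Definition opV (a : nat -> R) (beta : R) : 'M[R]_N.+1 :=
  op_of (fun n =>
    ((beta - n%:R) * (n%:R - beta - 1)) *: ket n
    - (if n is k.+1 then (n%:R * (N.+1 - n)%:R / a k) *: ket k else 0)).

Definition opW (a : nat -> R) (alpha beta mu : R) : 'M[R]_N.+1 :=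
  opX a alpha beta + mu *: opZ a.

Definition eigV (beta : R) (n : nat) : R :=
  (beta - n%:R) * (n%:R - beta - 1).

Definition eigW (alpha mu : R) (n : nat) : R := n%:R - alpha - mu.

(* A |v_n> = lam_n |v_n>, where the coefficient of |n> in |v_n> is 1. *)
Definition normalized_eigenvectors (A : 'M[R]_N.+1) (lam : nat -> R)
    (v : 'I_N.+1 -> 'cV[R]_N.+1) : Prop :=
  forall n : 'I_N.+1, A *m v n = lam n *: v n /\ v n n 0 = 1.

End MetaHahn.

(* The Pochhammer symbol (x)_k = x (x + 1) ... (x + k - 1). *)
Definition poch (R : realType) (x : R) (k : nat) : R :=
  \prod_(j < k) (x + j%:R).

(* The Hahn polynomial Q_m(x; ah, bh, N), for m <= N. *)
Definition hahn (R : realType) (m : nat) (x ah bh : R) (N : nat) : R :=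
  \sum_(l < m.+1)
    (poch (- m%:R) l * poch (m%:R + ah + bh + 1) l * poch (- x) l)
    / (l`!%:R * poch (- N%:R) l * poch (ah + 1) l).

(* Main.v *)
(* The four operators are bidiagonal, so every eigenvector has explicit
   hypergeometric coordinates, once the a_j are scaled away by the products
   G k = a_0 ... a_(k-1). For <e_m|f_n^*> the coordinate-wise products are the
   terms of the Hahn polynomial. For <e_m^*|f_n>, summation by parts turns the
   eigenvalue equation of e_m^* into a three-term recurrence in n, which by the
   difference equation of the Hahn polynomials also holds for the claimed
   right-hand side. Both solutions vanish at n = N + 1, where the Hahn weight
   has a zero, and they agree at n = N by the Chu-Vandermonde identity; the
   recurrence then propagates the equality downwards. *)
Require Import Defs.
From HB Require Import structures.
From mathcomp Require Import all_boot all_order all_algebra.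
From mathcomp Require Import reals.
From mathcomp Require Import ring.

Set Implicit Arguments.
Unset Strict Implicit.
Unset Printing Implicit Defensive.

Import Order.TTheory GRing.Theory Num.Theory.
Local Open Scope ring_scope.

(** * Pochhammer identities and the Chu-Vandermonde sum *)

Section Pochhammer.
Variable R : realType.
Implicit Types (x b c : R) (k m n : nat).

Lemma poch0 x : poch x 0 = 1.
Proof. by rewrite /poch big_ord0. Qed.

Lemma pochS x k : poch x k.+1 = poch x k * (x + k%:R).
Proof. by rewrite /poch big_ord_recr. Qed.

Lemma pochSl x k : poch x k.+1 = x * poch (x + 1) k.
Proof.
rewrite /poch big_ord_recl addr0; congr (_ * _); apply: eq_bigr => i _.
by rewrite -addrA -natr1 (addrC 1).
Qed.

Lemma poch_neq0W x k n : (k <= n)%N -> poch x n != 0 -> poch x k != 0.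
Proof.
elim: n => [|n IHn]; first by rewrite leqn0 => /eqP->.
rewrite leq_eqVlt => /orP[/eqP->//|]; rewrite ltnS => kn.
by rewrite pochS mulf_eq0 negb_or => /andP[/(IHn kn)].
Qed.

Lemma poch_factor_neq0 x k n : (k < n)%N -> poch x n != 0 -> x + k%:R != 0.
Proof.
by move=> kn /(poch_neq0W kn); rewrite pochS mulf_eq0 negb_or => /andP[].
Qed.

Lemma poch_oppn n k : (k <= n)%N ->
  poch (- n%:R : R) k * (n - k)`!%:R = (-1) ^+ k * n`!%:R.
Proof.
elim: k => [|k IHk] kn; first by rewrite poch0 expr0 subn0.
rewrite pochS exprS -mulrA mulN1r mulNr -IHk ?(ltnW kn)//.
have -> : - n%:R + k%:R = - (n - k)%:R :> R by rewrite natrB 1?ltnW//; ring.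
by rewrite -(subnSK kn) factS natrM; ring.
Qed.

Lemma poch_oppn_diag n : poch (- n%:R : R) n = (-1) ^+ n * n`!%:R.
Proof. by rewrite -poch_oppn// subnn fact0 mulr1. Qed.

Lemma poch_oppn_eq0 n k : (n < k)%N -> poch (- n%:R : R) k = 0.
Proof.
elim: k => // k IHk; rewrite ltnS leq_eqVlt pochS => /orP[/eqP->|/IHk->].
  by rewrite addNr mulr0.
by rewrite mul0r.
Qed.

Lemma poch_oppn_neq0 n k : (k <= n)%N -> poch (- n%:R : R) k != 0.
Proof.
move=> kn; have : (-1) ^+ k * n`!%:R != 0 :> R.
  by rewrite mulf_neq0 ?signr_eq0 // pnatr_eq0 -lt0n fact_gt0.
by rewrite -poch_oppn// mulf_eq0 negb_or => /andP[].
Qed.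

(** The factors on the left are those of [poch x m], negated and in reverse order. *)
Lemma poch_reflect x m : poch (1 - x - m%:R) m = (-1) ^+ m * poch x m.
Proof.
elim: m => [|m IHm]; first by rewrite !poch0 expr0 mulr1.
rewrite pochSl pochS exprS -natr1.
have -> : 1 - x - (m%:R + 1) + 1 = 1 - x - m%:R :> R by ring.
by rewrite IHm; ring.
Qed.

(** Pascal's rule, with the second half of the sum reindexed. *)
Lemma sum_binS m (X : nat -> R) :
  \sum_(l < m.+2) 'C(m.+1, l)%:R * X l =
  \sum_(l < m.+1) 'C(m, l)%:R * (X l + X l.+1).
Proof.
rewrite big_ord_recl /= bin0 /bump /=.
under eq_bigr do rewrite add1n binS natrD mulrDl.
rewrite big_split /= addrA.
have -> : 1 * X 0%N + \sum_(l < m.+1) 'C(m, l.+1)%:R * X l.+1 =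
    \sum_(l < m.+2) 'C(m, l)%:R * X l.
  by rewrite [RHS]big_ord_recl bin0.
rewrite big_ord_recr /= bin_small// mul0r addr0 -big_split /=.
by apply: eq_bigr => l _; rewrite mulrDr.
Qed.

(** Chu-Vandermonde cleared of denominators, hence valid for every [c]. After Pascal's rule the
    terms [l] and [l + 1] combine with the factor [(c + l) - (b + l) = c - b], which leaves the sum
    for [m] and [c + 1]. *)
Lemma sum_bin_poch m b c :
  \sum_(l < m.+1) 'C(m, l)%:R * ((-1) ^+ l * poch b l * poch (c + l%:R) (m - l))
  = poch (c - b) m.
Proof.
elim: m c => [|m IHm] c.
  by rewrite big_ord_recl big_ord0 !poch0 bin0 expr0 !mulr1 addr0.
rewrite (sum_binS m (fun l => (-1) ^+ l * poch b l * poch (c + l%:R) (m.+1 - l))).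
rewrite pochSl addrAC -IHm mulr_sumr; apply: eq_bigr => -[l /= lm] _.
rewrite subSn// subSS pochSl pochS exprS.
have -> : c + l.+1%:R = c + 1 + l%:R by rewrite -natr1; ring.
have -> : c + l%:R + 1 = c + 1 + l%:R by ring.
ring.
Qed.

Lemma pochD x k j : poch x (k + j) = poch x k * poch (x + k%:R) j.
Proof.
elim: j => [|j IHj]; first by rewrite addn0 poch0 mulr1.
by rewrite addnS !pochS IHj natrD; ring.
Qed.

Lemma chu_vandermonde m b c : poch c m != 0 ->
  \sum_(l < m.+1) poch (- m%:R) l * poch b l / (l`!%:R * poch c l) =
  poch (c - b) m / poch c m.
Proof.
move=> cm0; rewrite -sum_bin_poch mulr_suml; apply: eq_bigr => -[l /=].
rewrite ltnS => lm _.
have l0 : l`!%:R != 0 :> R by rewrite pnatr_eq0 -lt0n fact_gt0.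
have ml0 : (m - l)`!%:R != 0 :> R by rewrite pnatr_eq0 -lt0n fact_gt0.
have cl0 := poch_neq0W lm cm0.
have E : poch c m = poch c l * poch (c + l%:R) (m - l).
  by rewrite -pochD subnKC.
have d0 : poch (c + l%:R) (m - l) != 0.
  by move: cm0; rewrite E mulf_eq0 negb_or => /andP[].
have B : 'C(m, l)%:R * l`!%:R * (m - l)`!%:R = m`!%:R :> R.
  by rewrite -!natrM -mulnA bin_fact.
have P : poch (- m%:R) l = (-1) ^+ l * 'C(m, l)%:R * l`!%:R :> R.
  by apply: (mulIf ml0); rewrite poch_oppn// -B; ring.
rewrite P E; field.
by rewrite l0 cl0 d0.
Qed.

End Pochhammer.

(** * Difference equation of the Hahn polynomials and the weighted recurrence *)

Section HahnRecurrence.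
Variables (R : realType) (N m : nat) (ah bh : R).
Hypothesis mN : (m <= N)%N.

Let s := ah + bh + 1.
Let lam (x : R) := x * (x + s).

Lemma poch_opp_shift (x : R) l :
  poch (- (x + 1)) l.+1 = - (x + 1) * poch (- x) l.
Proof. by rewrite pochSl; congr (_ * poch _ _); ring. Qed.

(** In the basis [poch (- x) l] the difference operator is bidiagonal, and the ratio of consecutive
    Hahn coefficients makes the contributions telescope. *)
Lemma hahn_difference_equation (x : R) : poch (ah + 1) m != 0 ->
  (x + ah + 1) * (x - N%:R) * (hahn m (x + 1) ah bh N - hahn m x ah bh N)
  + x * (x - bh - N%:R - 1) * (hahn m (x - 1) ah bh N - hahn m x ah bh N)
  = lam m%:R * hahn m x ah bh N.
Proof.
move=> ah0.
pose h l := poch (- m%:R) l * poch (m%:R + ah + bh + 1) l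
  / (l`!%:R * poch (- N%:R) l * poch (ah + 1) l) : R.
have hahnE y : hahn m y ah bh N = \sum_(l < m.+1) h l * poch (- y) l.
  by apply: eq_bigr => l _; rewrite /h; ring.
pose u y l := (x + ah + 1) * (x - N%:R) * (poch (- (x + 1)) l - poch (- x) l)
  + x * (x - bh - N%:R - 1) * (poch (- (x - 1)) l - poch (- x) l)
  - y * poch (- x) l.
(* The partial sums of the residual have a closed form, whose factor [M - m] vanishes at [M = m]. *)
suff H M : (M <= m)%N -> \sum_(l < M.+1) h l * u (lam m%:R) l =
    (M%:R - m%:R) * (M%:R + m%:R + s) * (h M * poch (- x) M).
  apply/eqP; rewrite -subr_eq0 !hahnE -!sumrB !mulr_sumr -!big_split -sumrB /=.
  have := H m (leqnn m); rewrite subrr !mul0r => H0.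
  rewrite -[X in _ == X]H0; apply/eqP; apply: eq_bigr => l _.
  by rewrite /u; ring.
elim: M => [|M IHM] Mm.
  by rewrite big_ord_recl big_ord0 /u /h /lam !poch0 fact0; field.
rewrite big_ord_recr /= IHM ?(ltnW Mm)//.
have hS : h M.+1 * (M.+1%:R * (M%:R - N%:R) * (ah + 1 + M%:R)) =
    (M%:R - m%:R) * (M%:R + m%:R + s) * h M.
  rewrite /h factS natrM !pochS /s.
  have h1 := poch_factor_neq0 Mm ah0.
  have h2 := poch_factor_neq0 (leq_trans Mm mN) (poch_oppn_neq0 R (leqnn N)).
  have h3 := poch_oppn_neq0 R (leq_trans (ltnW Mm) mN).
  have h4 := poch_neq0W (ltnW Mm) ah0.
  have h5 : M`!%:R != 0 :> R by rewrite pnatr_eq0 -lt0n fact_gt0.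
  have h6 : 1 + M%:R != 0 :> R by rewrite addrC natr1 pnatr_eq0.
  field.
  by rewrite h1 h2 h3 h4 h5 h6.
have uS : u (lam m%:R) M.+1 =
   (M.+1%:R - m%:R) * (M.+1%:R + m%:R + s) * poch (- x) M.+1
   - M.+1%:R * (M%:R - N%:R) * (ah + 1 + M%:R) * poch (- x) M.
  (* Both sides are [- poch (- x) M.+2], with its first or its last factor split off. *)
  have xm : x * poch (- (x - 1)) M.+1 = (x - M.+1%:R) * poch (- x) M.+1.
    have := pochS (- x) M.+1.
    rewrite -{1}(subrK 1 x) poch_opp_shift subrK => /eqP.
    rewrite mulNr -subr_eq0 => /eqP E; apply/eqP; rewrite -subr_eq0 -oppr_eq0.
    by apply/eqP; rewrite -E; ring.
  rewrite /u poch_opp_shift.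
  have -> : x * (x - bh - N%:R - 1) * (poch (- (x - 1)) M.+1 - poch (- x) M.+1)
     = (x - bh - N%:R - 1) * (x * poch (- (x - 1)) M.+1 - x * poch (- x) M.+1).
    by ring.
  by rewrite xm pochS /lam /s -natr1; ring.
rewrite uS mulrBr.
have -> : h M.+1 * (M.+1%:R * (M%:R - N%:R) * (ah + 1 + M%:R) * poch (- x) M)
   = (M%:R - m%:R) * (M%:R + m%:R + s) * h M * poch (- x) M.
  by rewrite -hS; ring.
ring.
Qed.

(** At [x = N] the factor [poch (- N%:R) l] cancels, and the remaining 2F1 at 1 is a Chu-Vandermonde
    sum. *)
Lemma hahn_at_N : poch (ah + 1) m != 0 ->
  hahn m N%:R ah bh N * poch (ah + 1) m = (-1) ^+ m * poch (bh + 1) m.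
Proof.
move=> ah0; rewrite -poch_reflect.
have -> : 1 - (bh + 1) - m%:R = ah + 1 - (m%:R + ah + bh + 1) by ring.
rewrite -[RHS](divfK ah0) -chu_vandermonde//; congr (_ * _).
apply: eq_bigr => -[l /=]; rewrite ltnS => lm _.
have := poch_oppn_neq0 R (leq_trans lm mN).
have := poch_neq0W lm ah0.
have : l`!%:R != 0 :> R by rewrite pnatr_eq0 -lt0n fact_gt0.
by move=> l0 al0 N0; field; rewrite l0 al0 N0.
Qed.

(* The falling factorial N ^_ n stands for N! / (N - n)!, so that this vanishes
   at n = N + 1. *)
Definition weighted_hahn n : R :=
  (N ^_ n)%:R * poch (ah + 1) n * poch (bh + 1) (N - n) * hahn m n%:R ah bh N.

(** Minus the coefficient of Q_m(n) in the difference equation. *)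
Definition diff_diag n : R :=
  (n%:R + ah + 1) * (n%:R - N%:R) + n%:R * (n%:R - bh - N%:R - 1).

(** The difference equation at the point [n + 1], rewritten for Q_m times its weight. For
    [n = N - 1] it involves the value at [N + 1]. *)
Definition solves_recurrence (u : nat -> R) := forall n, (n < N)%N ->
  - lam m%:R * u n.+1 = (N%:R + bh - n.+1%:R) * u n.+2
    + diff_diag n.+1 * u n.+1 + n.+1%:R * (N%:R - n%:R) * (ah + n.+1%:R) * u n.

Lemma weighted_hahn_recurrence : poch (ah + 1) m != 0 ->
  solves_recurrence weighted_hahn.
Proof.
move=> ah0 n nN.
have := hahn_difference_equation n.+1%:R ah0.
rewrite natr1 -[in n.+1%:R - 1]natr1 addrK => E.
(* [E1] and [E2] express the weights at [n + 2] and [n] through the weight at [n + 1]. *)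
have E1 : (N%:R + bh - n.+1%:R) * weighted_hahn n.+2 =
   (n.+1%:R + ah + 1) * (N%:R - n.+1%:R) * ((N ^_ n.+1)%:R * poch (ah + 1) n.+1
   * poch (bh + 1) (N - n.+1)) * hahn m n.+2%:R ah bh N.
  rewrite /weighted_hahn ffactnSr natrM natrB// (pochS _ n.+1).
  (* If [n + 1 = N], both sides contain the factor [N - (n + 1) = 0]. *)
  move: nN; rewrite leq_eqVlt => /orP[/eqP->|nN]; first by rewrite subrr; ring.
  rewrite -(subnSK nN) (pochS _ (N - n.+2)) natrB// -2!natr1; ring.
have E2 : (N%:R - n%:R) * (ah + n.+1%:R) * weighted_hahn n =
   (N%:R + bh - n%:R) * ((N ^_ n.+1)%:R * poch (ah + 1) n.+1
   * poch (bh + 1) (N - n.+1)) * hahn m n%:R ah bh N.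
  rewrite /weighted_hahn ffactnSr natrM natrB 1?ltnW// (pochS _ n).
  rewrite -(subnSK nN) (pochS _ (N - n.+1)) natrB// -natr1; ring.
rewrite E1 -!mulrA [X in _ + n.+1%:R * X]mulrA E2.
rewrite /weighted_hahn /diff_diag.
set w := (_ * _ * _ : R) in E1 E2 *.
rewrite mulrCA mulNr -E -natr1; ring.
Qed.

(** The coefficient of [u n] is nonzero for [n < N], because [ah + 1 + n] is a factor of
    [poch (ah + 1) N]; so the recurrence can be solved downwards. *)
Lemma solves_recurrence_unique (u v : nat -> R) : poch (ah + 1) N != 0 ->
  solves_recurrence u -> solves_recurrence v ->
  u N.+1 = v N.+1 -> u N = v N -> forall n, (n <= N)%N -> u n = v n.
Proof.
move=> ah0 uP vP uvS uvN.
(* The recurrence has order two, so the induction carries two consecutive values. *)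
suff H i : (i <= N)%N -> u (N - i)%N = v (N - i)%N /\ u (N - i).+1 = v (N - i).+1.
  by move=> n nN; have [] := H (N - n)%N (leq_subr _ _); rewrite subKn.
elim: i => [|i IHi] iN; first by rewrite subn0.
have [] := IHi (ltnW iN); rewrite -(subnSK iN).
have : (N - i.+1 < N)%N by rewrite -[ltnRHS](subnK iN) addnS ltnS leq_addr.
move: (N - i.+1)%N => n nN E1 E2; split=> //.
have := uP _ nN; rewrite E1 E2 vP// => /addrI/mulfI -> //.
rewrite !mulf_neq0 ?pnatr_eq0//.
  by rewrite subr_eq0 eqr_nat gtn_eqF.
have -> : ah + n.+1%:R = ah + 1 + n%:R by rewrite -natr1; ring.
exact: poch_factor_neq0 nN ah0.
Qed.

End HahnRecurrence.

(** * The sum over coordinates that represents the dual overlap *)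

Section Transform.
Variables (R : realType) (N m : nat) (ah bh : R).
Hypothesis mN : (m <= N)%N.

Let s := ah + bh + 1.
Let lam (x : R) := x * (x + s).

(** [g k] models the coordinate [k] of e_m^* times [a_0 ... a_(k-1)]; [g0] and [gS] are the
    eigenvalue equation of the transpose of V. *)
Variable g : nat -> R.
Hypothesis g0 : lam m%:R * g 0%N = 0.
Hypothesis gS : forall k, (k < N)%N ->
  (lam m%:R - lam k.+1%:R) * g k.+1 = k.+1%:R * (N%:R - k%:R) * g k.

(** The kernel multiplying [g k] is, up to a factor depending only on [n], the scaled coordinate [k]
    of f_n. *)
Definition dual_sum n : R :=
  \sum_(k < N.+1) g k * (poch (- k%:R) n * poch (ah + 1) k / k`!%:R).

Lemma dual_sum_recurrence : solves_recurrence N m ah bh dual_sum.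
Proof.
move=> n nN.
pose c k : R := poch (ah + 1) k / k`!%:R.
pose P k : R := poch (- k%:R) n.+1 * c k.
have dE j : dual_sum j = \sum_(k < N.+1) g k * (poch (- k%:R) j * c k).
  by apply: eq_bigr => k _; rewrite /c !mulrA.
have cS k : k.+1%:R * c k.+1 = (ah + 1 + k%:R) * c k.
  rewrite /c factS natrM pochS -natr1; field.
  by rewrite natr1 !pnatr_eq0 -lt0n fact_gt0.
(* The recurrence operator in [n], applied to the kernel, becomes a first-order operator in [k]. *)
have point k : (N%:R + bh - n.+1%:R) * (g k * (poch (- k%:R) n.+2 * c k))
    + diff_diag N ah bh n.+1 * (g k * (poch (- k%:R) n.+1 * c k))
    + n.+1%:R * (N%:R - n%:R) * (ah + n.+1%:R) * (g k * (poch (- k%:R) n * c k))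
   = - lam k%:R * (g k * P k) - k.+1%:R * (N%:R - k%:R) * g k * P k.+1.
  have -> : k.+1%:R * (N%:R - k%:R) * g k * P k.+1 =
      (N%:R - k%:R) * g k * poch (- k.+1%:R) n.+1 * (k.+1%:R * c k.+1).
    by rewrite /P; ring.
  rewrite cS /P -(natr1 k) poch_opp_shift !pochS /diff_diag /lam /s -!natr1.
  ring.
rewrite !dE !mulr_sumr -!big_split /=.
under [RHS]eq_bigr do rewrite point.
(* The term [k = N] drops out through its factor [N - k]. *)
rewrite sumrB [X in _ - X]big_ord_recr /= subrr mulr0 !mul0r addr0.
(* Summation by parts: after the shift of [k], [gS] applies, and the new term [k = 0] vanishes by
   [g0]. The [lam k] parts then cancel. *)
have -> : \sum_(k < N) k.+1%:R * (N%:R - k%:R) * g k * P k.+1 =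
    \sum_(k < N.+1) (lam m%:R - lam k%:R) * g k * P k.
  rewrite [RHS]big_ord_recl /=.
  have -> : (lam m%:R - lam 0%:R) * g 0%N * P 0%N = 0.
    by rewrite mulrBl g0 /lam !mul0r subr0 mul0r.
  by rewrite add0r; apply: eq_bigr => -[k /= kN] _; rewrite -gS.
rewrite -sumrB; apply: eq_bigr => k _; rewrite /P /lam /s; ring.
Qed.

Lemma dual_sum_gtN n : (N < n)%N -> dual_sum n = 0.
Proof.
move=> Nn; rewrite /dual_sum big1// => -[k /= kN] _.
by rewrite poch_oppn_eq0 ?(leq_trans kN)// !mul0r mulr0.
Qed.

(** Only [k = N] survives, since [poch (- k%:R) N] is zero for [k < N]. *)
Lemma dual_sum_N : dual_sum N = (-1) ^+ N * poch (ah + 1) N * g N.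
Proof.
rewrite /dual_sum big_ord_recr /= big1 ?add0r => [|[k /= kN] _]; last first.
  by rewrite poch_oppn_eq0// !mul0r mulr0.
by rewrite poch_oppn_diag; field; rewrite pnatr_eq0 -lt0n fact_gt0.
Qed.

(** The constant is read off at [n = N], from [dual_sum_N] and [hahn_at_N]. *)
Lemma dual_sumE n : (n <= N)%N ->
  poch (ah + 1) N != 0 -> poch (bh + 1) m != 0 ->
  dual_sum n = (-1) ^+ (N + m) * g N * poch (ah + 1) m
    / (N`!%:R * poch (bh + 1) m) * weighted_hahn N m ah bh n.
Proof.
move=> nN ah0 bh0; have ahm0 := poch_neq0W mN ah0.
move: n nN; apply: (solves_recurrence_unique ah0 dual_sum_recurrence).
- move=> n nN; have := weighted_hahn_recurrence bh mN ahm0 nN.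
  set K := _ / _ => E; rewrite mulrCA E; ring.
- by rewrite dual_sum_gtN// /weighted_hahn ffact_small// !mul0r mulr0.
have h : hahn m N%:R ah bh N = (-1) ^+ m * poch (bh + 1) m / poch (ah + 1) m.
  by rewrite -(hahn_at_N bh mN ahm0) mulfK.
rewrite dual_sum_N /weighted_hahn h subnn poch0 ffactnn exprD.
have e : (-1) ^+ m * (-1) ^+ m = 1 :> R by rewrite -expr2 sqrr_sign.
rewrite -[LHS]mul1r -[X in X * _ = _]e; field.
by rewrite ahm0 bh0 pnatr_eq0 -lt0n fact_gt0.
Qed.

(** Iteration of [gS] from [m] up to [N]: the difference [lam m - lam (m + i + 1)] is
    [- (i + 1) (d + i)], and these factors build up [poch d]. *)
Lemma dual_coef_N : poch ((2 * m)%:R + ah + bh + 2) (N - m) != 0 ->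
  g N = (-1) ^+ (N - m) * N`!%:R
        / (m`!%:R * poch ((2 * m)%:R + ah + bh + 2) (N - m)) * g m.
Proof.
move=> d0; set d := (2 * m)%:R + ah + bh + 2 in d0 *.
have H i : (i <= N - m)%N -> g (m + i)%N * (i`!%:R * poch d i * (N - m - i)`!%:R
    * m`!%:R) = (-1) ^+ i * (m + i)`!%:R * (N - m)`!%:R * g m.
  elim: i => [|i IHi] iN; first by rewrite addn0 poch0 subn0 fact0 expr0; ring.
  have mi : (m + i < N)%N by rewrite -ltn_subRL.
  have := gS mi; rewrite -addnS.
  have -> : lam m%:R - lam (m + i.+1)%:R = - (i.+1%:R * (d + i%:R)).
    by rewrite /lam /d /s natrM natrD -natr1; ring.
  have -> : N%:R - (m + i)%:R = (N - m - i)%:R :> R.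
    by rewrite -subnDA natrB// ltnW.
  move=> E; rewrite factS natrM pochS exprS.
  have := IHi (ltnW iN).
  rewrite -{1}(subnSK iN) factS natrM subnSK// => F.
  transitivity (- (m + i).+1%:R * ((-1) ^+ i * (m + i)`!%:R * (N - m)`!%:R * g m));
    last by rewrite addnS factS natrM; ring.
  rewrite -F.
  transitivity (i`!%:R * poch d i * (N - m - i.+1)`!%:R * m`!%:R
    * - (- (i.+1%:R * (d + i%:R)) * g (m + i.+1)%N)); first by ring.
  by rewrite E addnS; ring.
have := H _ (leqnn _); rewrite subnKC// subnn fact0.
have f0 k : k`!%:R != 0 :> R by rewrite pnatr_eq0 -lt0n fact_gt0.
move=> E; apply: (mulIf (f0 (N - m)%N)).
have /mulIf : poch d (N - m) * m`!%:R != 0 by rewrite mulf_neq0.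
apply; transitivity (g N * ((N - m)`!%:R * poch d (N - m) * 1 * m`!%:R)).
  by ring.
by rewrite E; field; rewrite d0 f0.
Qed.

End Transform.

(** * Eigenvectors of bidiagonal matrices in coordinates *)

Section Bidiagonal.
Variables (R : realType) (N : nat).
Implicit Types (M : 'M[R]_N.+1) (v : 'cV[R]_N.+1) (c d : nat -> R).

(** Indexing by natural numbers keeps recurrences free of casts; for [k > N], [inord] falls back to
    index 0. *)
Definition coord v k : R := v (inord k) 0.

Lemma braketE u v : braket u v = \sum_(k < N.+1) coord u k * coord v k.
Proof.
by rewrite /braket mxE; apply: eq_bigr => k _; rewrite mxE /coord inord_val.
Qed.

Lemma sum_eq_nat k (F : 'I_N.+1 -> R) : (k <= N)%N ->
  \sum_(j < N.+1) (k == j :> nat)%:R * F j = F (inord k).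
Proof.
move=> kN; rewrite (bigD1 (inord k)) //= inordK// eqxx mul1r big1 ?addr0//.
move=> j; rewrite -val_eqE /= inordK// eq_sym => /negPf ->.
by rewrite mul0r.
Qed.

(** The condition [c N = 0] neutralizes the default value [coord v N.+1] at [k = N]. *)
Lemma upper_bidiagonal_eigen M c d v x :
  (forall i j : 'I_N.+1, M i j =
    (i == j :> nat)%:R * d i + (i.+1 == j :> nat)%:R * c i) ->
  c N = 0 -> M *m v = x *: v ->
  forall k, (k <= N)%N -> d k * coord v k + c k * coord v k.+1 = x * coord v k.
Proof.
move=> ME cN /matrixP Mv k kN; have := Mv (inord k) 0; rewrite !mxE => <-.
under eq_bigr do rewrite ME inordK// mulrDl -!mulrA.
rewrite big_split /= sum_eq_nat//; congr (_ + _).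
move: kN; rewrite leq_eqVlt => /orP[/eqP->|kN]; last by rewrite sum_eq_nat.
by rewrite cN mul0r big1// => j _; rewrite mul0r mulr0.
Qed.

Lemma lower_bidiagonal_eigen M c d v x :
  (forall i j : 'I_N.+1, M i j =
    (i == j :> nat)%:R * d j + (i == j.+1 :> nat)%:R * c j) ->
  M *m v = x *: v ->
  d 0%N * coord v 0 = x * coord v 0 /\
  forall k, (k < N)%N ->
    d k.+1 * coord v k.+1 + c k * coord v k = x * coord v k.+1.
Proof.
move=> ME /matrixP Mv.
have E k : (k <= N)%N -> d k * coord v k +
    \sum_(j < N.+1) (k == j.+1 :> nat)%:R * (c j * v j 0) = x * coord v k.
  move=> kN; have := Mv (inord k) 0; rewrite !mxE => <-.
  under [RHS]eq_bigr do rewrite ME inordK// mulrDl -!mulrA.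
  by rewrite big_split /= sum_eq_nat// inordK.
split; first by rewrite -E// big1 ?addr0// => j _; rewrite mul0r.
move=> k kN; rewrite -E//; congr (_ + _).
under [RHS]eq_bigr do rewrite eqSS.
by rewrite sum_eq_nat 1?ltnW// inordK// ltnS ltnW.
Qed.

Lemma opVE (a : nat -> R) beta (i j : 'I_N.+1) : opV N a beta i j =
  (i == j :> nat)%:R * eigV beta i
  + (i.+1 == j :> nat)%:R * - (i.+1%:R * (N%:R - i%:R) / a i).
Proof.
rewrite /opV /op_of !mxE; case: (nat_of_ord j) (ltn_ord j) => [|k] /= kN.
  by rewrite mxE mul0r subr0 addr0 mulrC; case: eqP => [->//|_]; rewrite !mul0r.
rewrite !mxE eqSS; congr (_ + _).
  by rewrite mulrC; case: eqP => [->//|_]; rewrite !mul0r.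
case: eqP => [->|_]; last by rewrite !(mulr0, mul0r) oppr0.
by rewrite mulr1 mul1r subSS natrB// ltnW.
Qed.

Lemma opWE (a : nat -> R) alpha beta mu (i j : 'I_N.+1) :
  opW N a alpha beta mu i j =
  (i == j :> nat)%:R * eigW alpha mu j
  + (i == j.+1 :> nat)%:R * (a j * (beta + mu - j%:R)).
Proof. by rewrite /opW /opX /opZ /op_of /eigW !mxE; ring. Qed.

(* The zero of c at n is where the normalization u n = w n restarts the
   recurrence. *)
Lemma first_order_unique n c d (u w : nat -> R) :
  (forall k, (k <= N)%N -> k != n -> c k != 0) ->
  c 0%N * u 0%N = 0 -> c 0%N * w 0%N = 0 ->
  (forall k, (k < N)%N -> c k.+1 * u k.+1 = d k * u k) ->
  (forall k, (k < N)%N -> c k.+1 * w k.+1 = d k * w k) ->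
  u n = w n -> forall k, (k <= N)%N -> u k = w k.
Proof.
move=> c0 u0 w0 uS wS uwn; elim=> [|k IHk] kN.
  have [->//|n0] := eqVneq 0%N n.
  by apply: (mulfI (c0 _ kN n0)); rewrite u0.
have [->//|kn] := eqVneq k.+1 n.
by apply: (mulfI (c0 _ kN kn)); rewrite uS// wS// IHk// ltnW.
Qed.

End Bidiagonal.

(** * Coordinates of the four eigenvectors and their overlaps *)

Section Overlaps.
Variables (R : realType) (N : nat) (a : nat -> R) (alpha beta mu : R).
Hypotheses (a0 : forall j, (j < N)%N -> a j != 0) (aN : a N = 0).

Let ah := - 1 - beta - mu.
Let bh := mu - beta - 1.
Let s := ah + bh + 1.
Let lam (x : R) := x * (x + s).
Let G k := \prod_(0 <= j < k) a j.

Let G0 k : (k <= N)%N -> G k != 0.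
Proof.
elim: k => [|k IHk] kN; first by rewrite /G big_geq ?oner_neq0.
by rewrite /G big_nat_recr//= mulf_neq0 ?a0// IHk// ltnW.
Qed.

Let GS k : G k.+1 = G k * a k.
Proof. by rewrite /G big_nat_recr. Qed.

(** [eigV beta k] equals [- lam k] up to an additive constant, which links V to the Hahn
    eigenvalue. *)
Let eigVB k l : eigV beta k - eigV beta l = lam l%:R - lam k%:R.
Proof. by rewrite /eigV /lam /s /ah /bh; ring. Qed.

(** Dividing by [G] removes the a_j. For the transpose the scaling is by multiplication, so it
    cancels in every overlap. *)
Lemma opV_eigen_coord v (m : nat) : opV N a beta *m v = eigV beta m *: v ->
  forall k, (k < N)%N -> k.+1%:R * (N%:R - k%:R) * (coord v k.+1 / G k.+1) =
    (lam m%:R - lam k%:R) * (coord v k / G k).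
Proof.
move=> vE k kN; have := upper_bidiagonal_eigen
  (c := fun i => - (i.+1%:R * (N%:R - i%:R) / a i)) (opVE a beta) _ vE (ltnW kN).
rewrite subrr mulr0 mul0r oppr0 => /(_ erefl) E.
rewrite -eigVB mulrA mulrBl -E GS; field.
by rewrite a0// G0// ltnW.
Qed.

Lemma opV_tr_eigen_coord v (m : nat) :
  (opV N a beta)^T *m v = eigV beta m *: v ->
  lam m%:R * (coord v 0 * G 0) = 0 /\
  forall k, (k < N)%N -> (lam m%:R - lam k.+1%:R) * (coord v k.+1 * G k.+1) =
    k.+1%:R * (N%:R - k%:R) * (coord v k * G k).
Proof.
have ME (i j : 'I_N.+1) : (opV N a beta)^T i j =
    (i == j :> nat)%:R * eigV beta j
    + (i == j.+1 :> nat)%:R * - (j.+1%:R * (N%:R - j%:R) / a j).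
  by rewrite mxE opVE (eq_sym (j : nat)) (eq_sym j.+1).
move=> /(lower_bidiagonal_eigen (c := fun j => - (j.+1%:R * (N%:R - j%:R) / a j))
  ME)[v0 vS]; split.
  have /eqP := v0; rewrite -subr_eq0 -mulrBl eigVB [lam 0%:R]mul0r subr0.
  by move=> /eqP E; rewrite mulrA E mul0r.
move=> k kN; have E := vS k kN.
rewrite -eigVB mulrA mulrBl -E GS; field.
exact: a0.
Qed.

(** The subdiagonal entry [a k * (beta + mu - k)] is [- a k * (ah + 1 + k)], which is where [ah]
    comes from; [alpha] cancels in differences of eigenvalues. *)
Lemma opW_eigen_coord v (n : nat) :
  opW N a alpha beta mu *m v = eigW alpha mu n *: v ->
  n%:R * (coord v 0 / G 0) = 0 /\
  forall k, (k < N)%N -> (k.+1%:R - n%:R) * (coord v k.+1 / G k.+1) =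
    (ah + 1 + k%:R) * (coord v k / G k).
Proof.
move=> /(lower_bidiagonal_eigen (d := eigW alpha mu)
  (c := fun k => a k * (beta + mu - k%:R)) (opWE a alpha beta mu))[v0 vS]; split.
  have /eqP := v0; rewrite -subr_eq0 -mulrBl.
  have -> : eigW alpha mu 0 - eigW alpha mu n = - n%:R by rewrite /eigW; ring.
  by rewrite mulNr oppr_eq0 mulrA => /eqP->; rewrite mul0r.
move=> k kN; have E := vS k kN.
have -> : k.+1%:R - n%:R = eigW alpha mu k.+1 - eigW alpha mu n.
  by rewrite /eigW; ring.
have ak := a0 kN; have Gk := G0 (ltnW kN).
apply: (mulIf (mulf_neq0 Gk ak)).
rewrite -GS -mulrA divfK ?G0// mulrBl -E GS /ah; field.
exact: Gk.
Qed.

Lemma opW_tr_eigen_coord v (n : nat) :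
  (opW N a alpha beta mu)^T *m v = eigW alpha mu n *: v ->
  forall k, (k < N)%N -> (ah + 1 + k%:R) * (coord v k.+1 * G k.+1) =
    (k%:R - n%:R) * (coord v k * G k).
Proof.
have ME (i j : 'I_N.+1) : (opW N a alpha beta mu)^T i j =
    (i == j :> nat)%:R * eigW alpha mu i
    + (i.+1 == j :> nat)%:R * (a i * (beta + mu - i%:R)).
  by rewrite mxE opWE (eq_sym (j : nat)) (eq_sym (j : nat)).
move=> vE k kN; have := upper_bidiagonal_eigen (d := eigW alpha mu)
  (c := fun i => a i * (beta + mu - i%:R)) ME _ vE (ltnW kN).
rewrite aN mul0r => /(_ erefl) E.
have -> : k%:R - n%:R = eigW alpha mu k - eigW alpha mu n.
  by rewrite /eigW; ring.
by rewrite [RHS]mulrA mulrBl -E GS /ah; ring.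
Qed.

Let coord_ord (v : 'cV[R]_N.+1) (i : 'I_N.+1) : v i 0 = coord v i.
Proof. by rewrite /coord inord_val. Qed.

Let factr_neq0 k : k`!%:R != 0 :> R.
Proof. by rewrite pnatr_eq0 -lt0n fact_gt0. Qed.

Lemma braket_e_fs (m n : 'I_N.+1) (e fs : 'cV[R]_N.+1) :
  opV N a beta *m e = eigV beta m *: e -> e m 0 = 1 ->
  (opW N a alpha beta mu)^T *m fs = eigW alpha mu n *: fs -> fs n 0 = 1 ->
  poch (ah + 1) N != 0 -> poch (m%:R + ah + bh + 1) m != 0 ->
  braket e fs = G n / G m
    * (N`!%:R * (-1) ^+ n / (n`!%:R * (N - m)`!%:R))
    * (poch (ah + 1) n / poch (m%:R + ah + bh + 1) m)
    * hahn m n%:R ah bh N.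
Proof.
rewrite !coord_ord => /opV_eigen_coord eS em /opW_tr_eigen_coord fS fn ahN ms0.
have mN : (m <= N)%N by rewrite -ltnS.
have nN : (n <= N)%N by rewrite -ltnS.
(* Both recurrences are solved upwards from index 0; the initial values [x] and [y] are determined
   at the end by the normalizations at [m] and [n]. *)
pose x := coord e 0 / G 0; pose y := coord fs 0 * G 0.
have eE k : (k <= N)%N -> coord e k / G k = x *
    (poch (- m%:R) k * poch (m%:R + ah + bh + 1) k
     / (k`!%:R * poch (- N%:R) k)).
  elim: k => [|k IHk] kN; first by rewrite !poch0 fact0 !(mulr1, divr1).
  have d0 : k.+1%:R * (N%:R - k%:R) != 0 :> R.
    by rewrite mulf_neq0 ?pnatr_eq0// subr_eq0 eqr_nat gtn_eqF.
  apply: (mulfI d0); rewrite eS// IHk 1?ltnW// factS natrM !pochS /lam /s.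
  have N0 := poch_oppn_neq0 R (ltnW kN).
  move: d0; rewrite mulf_eq0 negb_or -(natr1 k) => /andP[k0 Nk].
  field; rewrite N0 factr_neq0 k0 !andbT.
  by move: Nk; rewrite -oppr_eq0 opprB addrC.
have fE k : (k <= N)%N -> coord fs k * G k =
    y * (poch (- n%:R) k / poch (ah + 1) k).
  elim: k => [|k IHk] kN; first by rewrite !poch0 invr1 !mulr1.
  have d0 := poch_factor_neq0 kN ahN.
  apply: (mulfI d0); rewrite fS// IHk 1?ltnW// !pochS; field.
  by rewrite d0 (poch_neq0W (ltnW kN) ahN).
have sumE : braket e fs = x * y * hahn m n%:R ah bh N.
  rewrite braketE /hahn mulr_sumr.
  (* The Hahn sum is extended to all [k <= N]; coordinate products with [k > m] vanish because
     [poch (- m%:R) k = 0]. *)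
  rewrite (big_ord_widen N.+1 (fun l => x * y * (poch (- m%:R) l *
    poch (m%:R + ah + bh + 1) l * poch (- n%:R) l /
    (l`!%:R * poch (- N%:R) l * poch (ah + 1) l)))) ?ltnS//.
  rewrite [RHS]big_mkcond /=; apply: eq_bigr => -[k /=]; rewrite ltnS => kN _.
  have -> : coord e k * coord fs k = (coord e k / G k) * (coord fs k * G k).
    by field; rewrite G0.
  rewrite eE// fE//; case: ltnP => [_|mk]; last first.
    by rewrite poch_oppn_eq0// !(mul0r, mulr0).
  field; rewrite factr_neq0 (poch_neq0W kN ahN) poch_oppn_neq0//.
have pm := poch_oppn R mN; have pn := poch_oppn_diag R n.
have := fE n nN; rewrite fn mul1r => yE.
have := eE m mN; rewrite em mul1r => xE.
have an0 := poch_neq0W nN ahN.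
have sq k : (-1) ^+ k * (-1) ^+ k = 1 :> R by rewrite -expr2 sqrr_sign.
rewrite sumE; have -> : y = G n * poch (ah + 1) n * (-1) ^+ n / n`!%:R.
  rewrite yE pn -[LHS]mulr1 -[X in _ * X = _](sq n); field.
  by rewrite an0 factr_neq0.
have -> : x = (G m)^-1 * N`!%:R / ((N - m)`!%:R * poch (m%:R + ah + bh + 1) m).
  rewrite xE poch_oppn_diag.
  have -> : N`!%:R = (-1) ^+ m * (poch (- N%:R) m * (N - m)`!%:R) :> R.
    by rewrite pm mulrA sq mul1r.
  rewrite -[LHS]mulr1 -[X in _ * X = _](sq m); field.
  by rewrite factr_neq0 factr_neq0 ms0 poch_oppn_neq0.
by field; rewrite !factr_neq0 ms0 G0.
Qed.

Lemma braket_es_f (m n : 'I_N.+1) (es f : 'cV[R]_N.+1) :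
  (opV N a beta)^T *m es = eigV beta m *: es -> es m 0 = 1 ->
  opW N a alpha beta mu *m f = eigW alpha mu n *: f -> f n 0 = 1 ->
  poch (ah + 1) N != 0 -> poch (bh + 1) m != 0 ->
  poch ((2 * m)%:R + ah + bh + 2) (N - m) != 0 ->
  braket es f = (G N / G n) / (G N / G m)
    * (N`!%:R * (-1) ^+ n * poch (ah + 1) m
       / (m`!%:R * (N - n)`!%:R * poch (bh + 1) m))
    * (poch (bh + 1) (N - n) / poch ((2 * m)%:R + ah + bh + 2) (N - m))
    * hahn m n%:R ah bh N.
Proof.
rewrite !coord_ord => /opV_tr_eigen_coord[g0 gS] em.
move=> /opW_eigen_coord[f0 fS] fn ahN bhm m2s0.
have mN : (m <= N)%N by rewrite -ltnS.
have nN : (n <= N)%N by rewrite -ltnS.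
have an0 := poch_neq0W nN ahN.
pose g k := coord es k * G k.
(* Chosen so that the closed form below equals [1 / G n] at [k = n], given
   [poch (- n%:R) n = (-1) ^+ n * n!]. *)
pose x := (-1) ^+ n / (G n * poch (ah + 1) n).
have fE k : (k <= N)%N -> coord f k / G k =
    x * (poch (- k%:R) n * poch (ah + 1) k / k`!%:R).
  apply: (first_order_unique (n := n) (c := fun i => i%:R - n%:R)
    (d := fun i => ah + 1 + i%:R) (u := fun i => coord f i / G i)
    (w := fun i => x * (poch (- i%:R) n * poch (ah + 1) i / i`!%:R))).
  - by move=> i iN i_n; rewrite subr_eq0 eqr_nat.
  - by rewrite sub0r mulNr f0 oppr0.
  - case: (posnP n) => [->|n0]; first by rewrite subrr mul0r.
    by rewrite poch_oppn_eq0// !mul0r !mulr0.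
  - exact: fS.
  (* [E] splits the last and the first factor off [poch (- i.+1%:R) n.+1]. *)
  - move=> i iN; have E : (i.+1%:R - n%:R) * poch (- i.+1%:R) n =
        i.+1%:R * poch (- i%:R) n :> R.
      apply: oppr_inj; rewrite -!mulNr -[in RHS]natr1 -poch_opp_shift natr1 pochS.
      by ring.
    transitivity (x * ((i.+1%:R - n%:R) * poch (- i.+1%:R) n)
      * poch (ah + 1) i.+1 / i.+1`!%:R); first by ring.
    rewrite E pochS factS natrM; field.
    by rewrite factr_neq0 addrC natr1 pnatr_eq0.
  - have sq : (-1) ^+ n * (-1) ^+ n = 1 :> R by rewrite -expr2 sqrr_sign.
    rewrite fn mul1r poch_oppn_diag /x.
    rewrite -[LHS]mulr1 -[X in _ * X = _]sq; field.
    by rewrite factr_neq0 an0 G0.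
have sumE : braket es f = x * dual_sum N ah g n.
  rewrite braketE /dual_sum mulr_sumr; apply: eq_bigr => -[k /=].
  rewrite ltnS => kN _.
  transitivity (g k * (coord f k / G k)); first by rewrite /g; field; rewrite G0.
  by rewrite fE//; ring.
rewrite sumE (dual_sumE mN g0 gS nN ahN bhm) (dual_coef_N mN gS m2s0) /g em mul1r.
(* The signs contributed by [dual_sumE] and [dual_coef_N] cancel. *)
have sgn : (-1) ^+ (N + m) * (-1) ^+ (N - m) = 1 :> R.
  by rewrite -exprD -addnA subnKC// addnn -muln2 exprM sqrr_sign.
rewrite /weighted_hahn /x.
have -> : (N ^_ n)%:R = N`!%:R / (N - n)`!%:R :> R.
  by rewrite -(ffact_fact nN) natrM mulfK.
rewrite -[RHS]mul1r -[X in _ = X * _]sgn.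
move: ((-1) ^+ (N + m)) ((-1) ^+ (N - m)) => p q; field.
by rewrite !factr_neq0 an0 bhm m2s0 !G0.
Qed.

End Overlaps.

(** * Both overlaps as Hahn polynomials for generic parameters *)

Theorem proposition3 (R : realType) (N : nat) (a : nat -> R)
    (alpha beta mu : R) (e es f fs : 'I_N.+1 -> 'cV[R]_N.+1) :
  let ah := - 1 - beta - mu in
  let bh := mu - beta - 1 in
  (forall j : nat, (j < N)%N -> a j != 0) ->
  a N = 0 ->
  normalized_eigenvectors (opV N a beta) (eigV beta) e ->
  normalized_eigenvectors (opV N a beta)^T (eigV beta) es ->
  normalized_eigenvectors (opW N a alpha beta mu) (eigW alpha mu) f ->
  normalized_eigenvectors (opW N a alpha beta mu)^T (eigW alpha mu) fs ->
  (forall i j : 'I_N.+1, i != j -> eigV beta i != eigV beta j) ->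
  (forall l : 'I_N.+1, poch (ah + 1) l != 0) ->
  (forall m : 'I_N.+1, poch (bh + 1) m != 0) ->
  (forall m : 'I_N.+1, poch (m%:R + ah + bh + 1) m != 0) ->
  (forall m : 'I_N.+1, poch ((2 * m)%:R + ah + bh + 2) (N - m) != 0) ->
  forall m n : 'I_N.+1,
    braket (e m) (fs n) =
      (\prod_(0 <= j < n) a j) / (\prod_(0 <= j < m) a j)
      * (N`!%:R * (-1) ^+ n / (n`!%:R * (N - m)`!%:R))
      * (poch (ah + 1) n / poch (m%:R + ah + bh + 1) m)
      * hahn m n%:R ah bh N
    /\
    braket (es m) (f n) =
      (\prod_(n <= j < N) a j) / (\prod_(m <= j < N) a j)
      * (N`!%:R * (-1) ^+ n * poch (ah + 1) m
         / (m`!%:R * (N - n)`!%:R * poch (bh + 1) m))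
      * (poch (bh + 1) (N - n)
         / poch ((2 * m)%:R + ah + bh + 2) (N - m))
      * hahn m n%:R ah bh N.
Proof.
move=> ah bh a0 aN He Hes Hf Hfs _ ah0 bh0 ms0 m2s0 m n.
have ahN : poch (ah + 1) N != 0 := ah0 ord_max.
have [[eV em] [esV esm]] := (He m, Hes m).
have [[fW fn] [fsW fsn]] := (Hf n, Hfs n).
(* Products of the tail [a_k ... a_(N-1)] become quotients of initial products, the form used for
   the scaling. *)
have prodE k : (k <= N)%N -> \prod_(k <= j < N) a j =
    (\prod_(0 <= j < N) a j) / \prod_(0 <= j < k) a j.
  move=> kN; rewrite [\prod_(0 <= j < N) _](big_cat_nat (n := k))//= mulrAC divff ?mul1r//.
  rewrite prodf_seq_neq0; apply/allP => j; rewrite mem_index_iota => /andP[_ jk].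
  by apply/implyP => _; rewrite a0// (leq_trans jk).
have mN : (m <= N)%N by rewrite -ltnS.
have nN : (n <= N)%N by rewrite -ltnS.
split; first exact: (braket_e_fs a0 aN eV em fsW fsn).
rewrite (prodE n nN) (prodE m mN).
exact: (braket_es_f a0 esV esm fW fn).
Qed.
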